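(* Let $f(z)=h(z)+\overline{g(z)}=\sum_{n=1}^\infty a_nz^n+\sum_{n=1}^\infty\overline{b_n}\,\overline{z}^n\in\mathcal{B}_H(\lambda)$. (i) If $\lambda>1$, then $f(z)=O\big((1-|z|)^{1-\lambda}\big)$ as $|z|\to1$. (ii) If $\lambda<1$, then $f$ is bounded in $\mathbb{D}$ with the bound $(1+|b_1|)H_\lambda(1)$. (iii) If $\lambda>0$ and $f\in\mathcal{S}_H^0\cap\mathcal{B}_H(\lambda)$, then the image $f(\mathbb{D})$ contains the disk $\{w:|w|<-H_\lambda(-1)\}$.
   Context: $\mathbb{D}$ is the open unit disk. $\mathcal{H}$ is the class of harmonic mappings $f=h+\overline g$ in $\mathbb{D}$ ($h,g$ analytic) with $h(0)=g(0)=h'(0)-1=0$; thus $a_1=1$ and $b_1=g'(0)$. $\|T_f\|=\sup_{z\in\mathbb{D},\ \theta\in[0,2\pi]}(1-|z|^2)\left|\frac{h''(z)+e^{i\theta}g''(z)}{h'(z)+e^{i\theta}g'(z)}\right|$, with $\|T_f\|=\infty$ if $h'+e^{i\theta}g'$ has a zero in $\mathbb{D}$ for some $\theta$; and $\mathcal{B}_H(\lambda)=\{f\in\mathcal{H}:\|T_f\|\le 2\lambda\}$, where $\lambda\ge 0$. $\mathcal{S}_H^0$ is the set of $f\in\mathcal{H}$ that are sense-preserving (i.e. $|g'|<|h'|$ in $\mathbb{D}$) and univalent in $\mathbb{D}$ with $g'(0)=0$. $H_\lambda(x)=\int_0^x\left(\frac{1+t}{1-t}\right)^{\lambda}dt$;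 the values $H_\lambda(1)$ (for $\lambda<1$) and $H_\lambda(-1)$ are the corresponding (improper) integrals. *)

(* Defs.v *)
From Stdlib Require Export Reals.
From Stdlib Require Import ClassicalDescription.
From Coquelicot Require Export Coquelicot.

Local Open Scope R_scope.

Definition in_disk (z : C) : Prop := Cmod z < 1.

Definition analytic_in_disk (h : C -> C) : Prop :=
  forall z : C, in_disk z -> ex_derive (K := C_AbsRing) (V := C_NormedModule) h z.

(* Functions on the disk are represented by total functions C -> C; only their
   values in the disk matter.  A harmonic mapping f = h + conj g is represented
   by the pair (h, g), which f determines on the disk once g 0 = 0. *)
Definition harmonic_map (h g : C -> C) (z : C) : C := (h z + Cconj (g z))%C.

Definition class_H (h g : C -> C) : Prop :=
  analytic_in_disk h /\ analytic_in_disk g /\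
  h 0 = RtoC 0 /\ g 0 = RtoC 0 /\ C_derive h 0 = RtoC 1.

(* u z = sum_(n >= 1) a_n z^n throughout the disk; a 0 is never used. *)
Definition disk_expansion (a : nat -> C) (u : C -> C) : Prop :=
  forall z : C, in_disk z ->
    is_series (K := C_AbsRing) (V := C_NormedModule)
      (fun n : nat => (a (S n) * z ^ S n)%C) (u z).

Definition cis (theta : R) : C := (cos theta, sin theta).

Definition rotated_derive (h g : C -> C) (theta : R) (z : C) : C :=
  (C_derive h z + cis theta * C_derive g z)%C.

Definition rotated_derive2 (h g : C -> C) (theta : R) (z : C) : C :=
  (C_derive (C_derive h) z + cis theta * C_derive (C_derive g) z)%C.

Definition preSchwarzian_values (h g : C -> C) (x : R) : Prop :=
  exists (z : C) (theta : R),
    in_disk z /\ 0 <= theta <= 2 * PI /\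
    x = (1 - Cmod z ^ 2) *
        Cmod (rotated_derive2 h g theta z / rotated_derive h g theta z).

Definition rotated_derive_vanishes (h g : C -> C) : Prop :=
  exists (z : C) (theta : R),
    in_disk z /\ 0 <= theta <= 2 * PI /\ rotated_derive h g theta z = RtoC 0.

Definition preSchwarzian_norm (h g : C -> C) : Rbar :=
  if excluded_middle_informative (rotated_derive_vanishes h g)
  then p_infty
  else Lub_Rbar (preSchwarzian_values h g).

Definition class_BH (lambda : R) (h g : C -> C) : Prop :=
  class_H h g /\ Rbar_le (preSchwarzian_norm h g) (Finite (2 * lambda)).

Definition sense_preserving (h g : C -> C) : Prop :=
  forall z : C, in_disk z -> Cmod (C_derive g z) < Cmod (C_derive h z).

Definition univalent (f : C -> C) : Prop :=
  forall z1 z2 : C, in_disk z1 -> in_disk z2 -> f z1 = f z2 -> z1 = z2.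

Definition class_SH0 (h g : C -> C) : Prop :=
  class_H h g /\ sense_preserving h g /\ univalent (harmonic_map h g) /\
  C_derive g 0 = RtoC 0.

Definition H_integrand (lambda t : R) : R := Rpower ((1 + t) / (1 - t)) lambda.

(* The improper integrals H_lambda(1), convergent for lambda < 1, and
   H_lambda(-1), convergent for lambda > -1.  The latter runs from 0 down to
   -1, so it is negative. *)
Definition H_at_1 (lambda : R) : R :=
  RInt_gen (H_integrand lambda) (at_point 0) (at_left 1).

Definition H_at_m1 (lambda : R) : R :=
  RInt_gen (H_integrand lambda) (at_point 0) (at_right (-1)).

(* f(z) = O(phi(|z|)) as |z| -> 1 within the disk. *)
Definition bigO_at_circle (f : C -> C) (phi : R -> R) : Prop :=
  exists M r0 : R, r0 < 1 /\
    forall z : C, r0 < Cmod z < 1 -> Cmod (f z) <= M * Rabs (phi (Cmod z)).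

(* Main.v *)
Require Import Defs.
From Stdlib Require Import Lra Classical ClassicalEpsilon.
Local Open Scope R_scope.

(** For each [theta] put [q = h' + e^(i theta) g']. The norm condition says that [q] has
    no zero in the disk and that [|q' / q| <= 2 lambda / (1 - |z|^2)]. Integrating the
    logarithmic derivative along a radius yields, with
    [P (t) = ((1 + t) / (1 - t)) ^ lambda],
      [|q 0| P (-|z|) <= |q z| <= |q 0| P (|z|)]   (lemma [distortion]).
    The rotation is free, so it can be chosen at each point to align [h'] and [g'] or to
    oppose them. This gives
      [|h'| + |g'| <= (1 + |b_1|) P (|z|)]         (lemma [sum_derivatives_bound])
    and, when [f] preserves orientation and [g' 0 = 0],
      [|h'| - |g'| >= P (-|z|)]                    (lemma [diff_derivatives_bound]).

    Let [H] be the primitive of [P] that vanishes at 0. Since [|h'| + |g'|] is the norm of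
    the differential of [f], the upper bound integrates to
    [|f z| <= (1 + |b_1|) H (|z|)] (lemma [growth_bound]). For [lambda < 1] the right-hand
    side increases to its limit at 1; for [lambda > 1] it is compared with the
    primitive of [(2 / (1 - t)) ^ lambda].

    For the covering statement, [|h'| - |g'|] is the least stretching of the
    differential. The classical argument lifts the segment from 0 to [w]. Lemma
    [covering] replaces path lifting by a minimisation: with
    [Phi (x) = - H (-x)] and a suitable [c < 1], the function
    [|f z - w| + c Phi (|z|)] has an interior minimum on some closed disk of radius
    less than 1, and at such a point [f z = w], since otherwise a small displacement that
    sends [f z] straight towards [w] would shorten the distance faster than [c Phi] grows.

    The differentiability of [h'] and [g'], on which the argument rests, comes from the
    power series of [h] and [g] (lemma [power_series_derivable]). *)

(** * Complex differentiability *)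

(** Complex differentiability as the linear-approximation inequality itself, the form
    in which every estimate below produces or consumes it. *)
Definition cdiff (f : C -> C) (z l : C) : Prop :=
  forall eps : R, 0 < eps -> exists delta : R, 0 < delta /\
    forall w : C, Cmod (w - z) < delta ->
      Cmod (f w - f z - l * (w - z)) <= eps * Cmod (w - z).

Lemma is_derive_cdiff (f : C -> C) (z l : C) :
  is_derive (K := C_AbsRing) (V := C_NormedModule) f z l <-> cdiff f z l.
Proof.
  split.
  - intros [_ Hd] eps Heps.
    specialize (Hd z (fun P H => H) (mkposreal eps Heps)).
    destruct Hd as [[d Hd0] Hd]. simpl in *.
    exists d; split; [exact Hd0|].
    intros w Hw. specialize (Hd w Hw).
    replace (f w - f z - l * (w - z))%C with
      (minus (minus (f w) (f z)) (scal (minus w z) l)); [exact Hd|].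
    unfold minus, plus, opp, scal; simpl. unfold mult; simpl. ring.
  - intros Hd. split; [apply is_linear_scal_l|].
    intros x Hx.
    pose proof (is_filter_lim_locally_unique
                  (V := AbsRing_NormedModule C_AbsRing) _ _ Hx) as Hxz.
    rewrite <- Hxz. clear x Hx Hxz.
    intros [eps Heps].
    destruct (Hd eps Heps) as [d [Hd0 Hd1]].
    exists (mkposreal d Hd0). intros w Hw. simpl.
    specialize (Hd1 w Hw).
    eapply Rle_trans; [right|exact Hd1].
    change (Cmod (f w - f z - (w - z) * l) = Cmod (f w - f z - l * (w - z))).
    f_equal. ring.
Qed.

Lemma C_derive_cdiff (f : C -> C) (z l : C) : cdiff f z l -> C_derive f z = l.
Proof. intros H. apply is_C_derive_unique. now apply is_derive_cdiff. Qed.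

(** * Power series *)

(** Unlike [disk_expansion], the series starts at the constant term; this makes
    the property stable under [C_derive]. *)
Definition represents (c : nat -> C) (u : C -> C) : Prop :=
  forall z : C, in_disk z ->
    is_series (K := C_AbsRing) (V := C_NormedModule) (fun n => c n * z ^ n)%C (u z).

(** Induction on [n], using, for [k = n + 2],
    [w^(k+1) - z^(k+1) - (k+1) z^k (w-z)
       = w (w^k - z^k - k z^(k-1) (w-z)) + k z^(k-1) (w-z)^2].
    The right-hand side is, up to the factor [Cmod (w - z) ^ 2], the coefficient of
    a twice derived power series. *)
Lemma Cpow_taylor_bound (z w : C) (r : R) (n : nat) :
  Cmod z <= r -> Cmod w <= r ->
  Cmod (w ^ S (S n) - z ^ S (S n) - INR (S (S n)) * z ^ S n * (w - z))
    <= Cmod (w - z) ^ 2 * (INR (S n) * INR (S (S n)) * r ^ n).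
Proof.
  intros Hz Hw.
  assert (Hr : 0 <= r) by (pose proof (Cmod_ge_0 z); lra).
  induction n as [|n IH].
  - replace (w ^ 2 - z ^ 2 - INR 2 * z ^ 1 * (w - z))%C with ((w - z) * (w - z))%C.
    + rewrite Cmod_mult. simpl. pose proof (Cmod_ge_0 (w - z)). nra.
    + simpl. replace (RtoC (1 + 1)) with (RtoC 1 + RtoC 1)%C by now rewrite <- RtoC_plus.
      ring.
  - replace (w ^ S (S (S n)) - z ^ S (S (S n)) - INR (S (S (S n))) * z ^ S (S n) * (w - z))%C
      with (w * (w ^ S (S n) - z ^ S (S n) - INR (S (S n)) * z ^ S n * (w - z))
            + INR (S (S n)) * z ^ S n * ((w - z) * (w - z)))%C.
    + eapply Rle_trans; [apply Cmod_triangle|].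
      rewrite !Cmod_mult, Cmod_pow, Cmod_R.
      rewrite (Rabs_pos_eq (INR _)) by apply pos_INR.
      set (D := Cmod (w - z)) in *.
      assert (HD : 0 <= D) by apply Cmod_ge_0.
      assert (Hp : Cmod z ^ S n <= r ^ S n)
        by (apply pow_incr; split; [apply Cmod_ge_0|exact Hz]).
      assert (H1 := Rmult_le_compat _ _ _ _ (Cmod_ge_0 w) (Cmod_ge_0 _) Hw IH).
      assert (HDD : 0 <= D * D) by nra.
      assert (Hi : 0 <= INR (S (S n))) by apply pos_INR.
      assert (H2 : INR (S (S n)) * Cmod z ^ S n * (D * D)
                   <= INR (S (S n)) * r ^ S n * (D * D)).
      { apply Rmult_le_compat_r; [exact HDD|]. now apply Rmult_le_compat_l. }
      eapply Rle_trans; [exact (Rplus_le_compat _ _ _ _ H1 H2)|].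
      rewrite !S_INR. simpl pow.
      pose proof (pow_le r n Hr) as Hrn. pose proof (pos_INR n).
      assert (0 <= D * D * (r * r ^ n)) by (apply Rmult_le_pos; nra).
      nra.
    + rewrite (S_INR (S (S n))), RtoC_plus. simpl Cpow. ring.
Qed.

Lemma is_series_components (a : nat -> C) (s : C) :
  is_series (K := C_AbsRing) (V := C_NormedModule) a s ->
  is_series (fun n => fst (a n)) (fst s) /\ is_series (fun n => snd (a n)) (snd s).
Proof.
  intros H.
  assert (Hf : forall N, fst (sum_n a N) = sum_n (fun n => fst (a n)) N /\
                         snd (sum_n a N) = sum_n (fun n => snd (a n)) N).
  { induction N as [|N [IH1 IH2]]; [now rewrite !sum_O|].
    rewrite !sum_Sn, <- IH1, <- IH2. split; reflexivity. }
  unfold is_series in *. split.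
  - eapply filterlim_ext; [intros N; exact (proj1 (Hf N))|].
    apply (filterlim_comp _ _ _ (sum_n a) fst _ (locally s)); [exact H|].
    apply (continuous_fst (U := R_UniformSpace) (V := R_UniformSpace)).
  - eapply filterlim_ext; [intros N; exact (proj2 (Hf N))|].
    apply (filterlim_comp _ _ _ (sum_n a) snd _ (locally s)); [exact H|].
    apply (continuous_snd (U := R_UniformSpace) (V := R_UniformSpace)).
Qed.

Lemma is_series_bounded_terms (a : nat -> C) (s : C) :
  is_series (K := C_AbsRing) (V := C_NormedModule) a s ->
  exists M, forall n, Cmod (a n) <= M.
Proof.
  intros H. destruct (is_series_components a s H) as [H1 H2].
  assert (B : forall x : nat -> R, ex_series x -> exists M, forall n, Rabs (x n) <= M).
  { intros x Hx. apply ex_series_lim_0 in Hx.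
    destruct (maj_by_pos x) as [M [_ HM]]; [|now exists M].
    exists 0. now apply is_lim_seq_Reals. }
  destruct (B _ (ex_intro _ _ H1)) as [M1 HM1].
  destruct (B _ (ex_intro _ _ H2)) as [M2 HM2].
  exists (M1 + M2). intros n.
  specialize (HM1 n); specialize (HM2 n).
  replace (a n) with (fst (a n) + Ci * snd (a n))%C.
  - eapply Rle_trans; [apply Cmod_triangle|].
    rewrite Cmod_mult, Cmod_Ci, !Cmod_R. lra.
  - destruct (a n) as [x y]. unfold Ci, RtoC, Cplus, Cmult; simpl. f_equal; ring.
Qed.

Lemma is_series_norm_le (a : nat -> C) (s : C) (b : nat -> R) (B : R) :
  is_series (K := C_AbsRing) (V := C_NormedModule) a s ->
  is_series b B -> (forall n, Cmod (a n) <= b n) -> Cmod s <= B.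
Proof.
  intros Ha Hb Hab.
  apply (is_lim_seq_le (fun N => Cmod (sum_n a N)) (sum_n b) (Cmod s) B).
  - intros N. unfold sum_n.
    eapply Rle_trans; [apply (norm_sum_n_m (K := C_AbsRing) (V := C_NormedModule))|].
    apply sum_n_m_le. exact Hab.
  - unfold is_lim_seq.
    apply (filterlim_comp _ _ _ (sum_n a) Cmod _ (locally s)); [exact Ha|].
    apply (filterlim_norm (K := C_AbsRing) (V := C_NormedModule) s).
  - exact Hb.
Qed.

Lemma is_series_pad (a : nat -> C) (s : C) :
  a O = RtoC 0 ->
  is_series (K := C_AbsRing) (V := C_NormedModule) (fun n => a (S n)) s ->
  is_series (K := C_AbsRing) (V := C_NormedModule) a s.
Proof.
  intros H0 H. apply is_series_decr_1.
  change (plus s (opp (a O))) with (s - a O)%C. rewrite H0.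
  now replace (s - 0)%C with s by ring.
Qed.

(** The terms of a convergent series are bounded, so the real power series with
    coefficients [|c n|] converges on (-1, 1). From here on the real theory, including
    the invariance of the radius under termwise differentiation, supplies all the
    convergence needed. *)
Lemma represents_CV_radius (c : nat -> C) (u : C -> C) :
  represents c u -> Rbar_le 1 (CV_radius (fun n => Cmod (c n))).
Proof.
  intros H.
  destruct (CV_radius_bounded (fun n => Cmod (c n))) as [Hub _].
  assert (Hr : forall r, 0 <= r < 1 -> Rbar_le r (CV_radius (fun n => Cmod (c n)))).
  { intros r Hr. apply Hub.
    assert (Hd : in_disk (RtoC r)) by (unfold in_disk; rewrite Cmod_R, Rabs_pos_eq; lra).
    destruct (is_series_bounded_terms _ _ (H _ Hd)) as [M HM].
    exists M. intros n. specialize (HM n).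
    rewrite Cmod_mult, Cmod_pow, Cmod_R, (Rabs_pos_eq r) in HM by lra.
    rewrite Rabs_pos_eq; [exact HM|].
    apply Rmult_le_pos; [apply Cmod_ge_0|apply pow_le; lra]. }
  destruct (CV_radius (fun n => Cmod (c n))) as [R| |]; simpl in *; [|exact I|].
  - apply Rnot_lt_le. intros HR.
    specialize (Hr ((1 + Rmax 0 R) / 2)).
    pose proof (Rmax_l 0 R). pose proof (Rmax_r 0 R).
    assert (Rmax 0 R < 1) by (apply Rmax_lub_lt; lra).
    assert (0 <= (1 + Rmax 0 R) / 2 < 1) by lra. specialize (Hr H3). lra.
  - apply (Hr 0). lra.
Qed.

(** Termwise differentiation: the remainder [u w - u z - l (w - z)] is the sum of the
    Taylor remainders of the monomials, hence quadratic in [w - z]. *)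
Lemma power_series_derivable (c : nat -> C) (u : C -> C) (z : C) :
  represents c u -> in_disk z ->
  exists l, is_series (K := C_AbsRing) (V := C_NormedModule)
              (fun n => (INR (S n) * c (S n)) * z ^ n)%C l /\ cdiff u z l.
Proof.
  intros Hu Hz. unfold in_disk in Hz.
  set (a := fun n => Cmod (c n)).
  pose proof (represents_CV_radius c u Hu) as HCV. fold a in HCV.
  set (r := (1 + Cmod z) / 2).
  pose proof (Cmod_ge_0 z) as Hz0.
  assert (Hr : Cmod z < r < 1) by (unfold r; lra).
  assert (Hin : forall x, 0 <= x < 1 -> Rbar_lt (Rabs x) (CV_radius a)).
  { intros x Hx. rewrite Rabs_pos_eq by lra.
    eapply Rbar_lt_le_trans; [|exact HCV]. simpl. lra. }
  assert (E : ex_series (K := C_AbsRing) (V := C_NormedModule)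
                (fun n => (INR (S n) * c (S n)) * z ^ n)%C).
  { apply (ex_series_le (K := C_AbsRing) (V := C_CompleteNormedModule) _
             (fun n => Rabs (PS_derive a n * (Cmod z) ^ n))).
    - intros n. change (norm ?x) with (Cmod x).
      rewrite !Cmod_mult, Cmod_pow, Cmod_R, !Rabs_mult, <- RPow_abs.
      unfold PS_derive, a. rewrite Rabs_mult, !(Rabs_pos_eq (Cmod _)) by apply Cmod_ge_0.
      apply Rle_refl.
    - apply CV_disk_inside. rewrite CV_radius_derive. apply Hin. lra. }
  destruct E as [l Hl]. exists l. split; [exact Hl|].
  assert (E2 : ex_series (fun n => Rabs (PS_derive (PS_derive a) n * r ^ n))).
  { apply CV_disk_inside. rewrite !CV_radius_derive. apply Hin. lra. }
  destruct E2 as [B HB].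
  (* The n-th term of the remainder series vanishes for n = 0, 1, and for
     n = m + 2 it is at most |w - z|^2 times the m-th term of the second derived
     series of the moduli |c n| at r; its sum B therefore bounds them all. *)
  assert (Q : forall w, Cmod w <= r ->
     Cmod (u w - u z - l * (w - z)) <= Cmod (w - z) ^ 2 * B).
  { intros w Hw.
    assert (Hw1 : in_disk w) by (unfold in_disk; lra).
    assert (S1 : is_series (K := C_AbsRing) (V := C_NormedModule)
       (fun n => match n with O => RtoC 0 | S m => INR (S m) * c (S m) * z ^ m end)%C l).
    { now apply is_series_pad. }
    pose proof (is_series_minus _ _ _ _
      (is_series_minus _ _ _ _ (Hu w Hw1) (Hu z Hz))
      (is_series_scal (K := C_AbsRing) (w - z)%C _ _ S1)) as S2.
    apply (is_series_norm_le _ _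
      (fun n => match n with S (S m) =>
         Cmod (w - z) ^ 2 * Rabs (PS_derive (PS_derive a) m * r ^ m) | _ => 0 end)
      (Cmod (w - z) ^ 2 * B) ) in S2.
    - match type of S2 with Cmod ?x <= _ =>
        replace (u w - u z - l * (w - z))%C with x; [exact S2|] end.
      unfold plus, opp, scal; simpl. unfold mult; simpl. ring.
    - apply is_series_decr_1, is_series_decr_1.
      replace (plus _ _) with (Cmod (w - z) ^ 2 * B).
      + apply (is_series_scal (K := R_AbsRing) (V := R_NormedModule)
                 (Cmod (w - z) ^ 2) _ _ HB).
      + unfold plus, opp; simpl. ring.
    - assert (Hz1 : Cmod z <= r) by lra.
      intros [|[|m]]; unfold plus, opp, scal; simpl; unfold mult; simpl.
      + match goal with |- Cmod ?x <= _ => replace x with (RtoC 0) by ring end.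
        rewrite Cmod_0. lra.
      + match goal with |- Cmod ?x <= _ => replace x with (RtoC 0) by ring end.
        rewrite Cmod_0. lra.
      + pose proof (Cpow_taylor_bound z w r m Hz1 Hw) as T.
        apply (Rmult_le_compat_l (a (S (S m))) _ _ (Cmod_ge_0 _)) in T.
        unfold a at 1 in T. rewrite <- Cmod_mult in T.
        match type of T with Cmod ?x <= _ =>
         match goal with |- Cmod ?y <= _ => replace y with x end end.
        * eapply Rle_trans; [exact T|]. right.
          unfold PS_derive. rewrite Rabs_pos_eq.
          -- simpl. ring.
          -- repeat apply Rmult_le_pos; try apply pos_INR; [apply Cmod_ge_0|apply pow_le; lra].
        * change (match m with O => 1 | S _ => INR m + 1 end) with (INR (S m)).
          simpl Cpow. change (INR (S (S m))) with (INR (S m) + 1). ring. }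
  intros eps Heps.
  pose proof (Rabs_pos B).
  assert (He : 0 < eps / (Rabs B + 1)) by (apply Rdiv_lt_0_compat; lra).
  exists (Rmin (r - Cmod z) (eps / (Rabs B + 1))). split.
  - apply Rmin_pos; lra.
  - intros w Hw.
    assert (Hw1 : Cmod (w - z) < r - Cmod z)
      by (eapply Rlt_le_trans; [exact Hw|apply Rmin_l]).
    assert (Hw2 : Cmod (w - z) < eps / (Rabs B + 1))
      by (eapply Rlt_le_trans; [exact Hw|apply Rmin_r]).
    eapply Rle_trans; [apply Q|].
    + replace w with ((w - z) + z)%C by ring.
      eapply Rle_trans; [apply Cmod_triangle|]. lra.
    + pose proof (Cmod_ge_0 (w - z)). set (D := Cmod (w - z)) in *.
      apply (Rmult_lt_compat_r (Rabs B + 1)) in Hw2; [|lra].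
      unfold Rdiv in Hw2. rewrite Rmult_assoc, Rinv_l, Rmult_1_r in Hw2 by lra.
      pose proof (Rle_abs B). simpl. nra.
Qed.

Lemma represents_derive (c : nat -> C) (u : C -> C) :
  represents c u -> represents (fun n => INR (S n) * c (S n))%C (C_derive u).
Proof.
  intros Hu z Hz. destruct (power_series_derivable c u z Hu Hz) as [l [Hl Hd]].
  rewrite (C_derive_cdiff _ _ _ Hd). exact Hl.
Qed.

Lemma represents_cdiff (c : nat -> C) (u : C -> C) (z : C) :
  represents c u -> in_disk z -> cdiff u z (C_derive u z).
Proof.
  intros Hu Hz. destruct (power_series_derivable c u z Hu Hz) as [l [Hl Hd]].
  now rewrite (C_derive_cdiff _ _ _ Hd).
Qed.

Lemma represents_at_0 (c : nat -> C) (u : C -> C) : represents c u -> u 0 = c O.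
Proof.
  intros H.
  assert (H0 : in_disk 0) by (unfold in_disk; rewrite Cmod_0; lra).
  eapply (filterlim_locally_unique (K := C_AbsRing) (V := C_NormedModule) (F:=eventually));
    [exact (H _ H0)|].
  eapply filterlim_ext; [|apply filterlim_const].
  induction x as [|N IH].
  - rewrite sum_O. simpl. ring.
  - rewrite sum_Sn, <- IH. unfold plus; simpl. ring.
Qed.

Lemma disk_expansion_represents (a : nat -> C) (u : C -> C) :
  disk_expansion a u ->
  represents (fun n => match n with O => RtoC 0 | S _ => a n end) u.
Proof.
  intros H z Hz. apply is_series_pad; [ring|exact (H z Hz)].
Qed.

(** * Calculus along rays of the disk *)

Lemma exp_monotone (x y : R) : x <= y -> exp x <= exp y.
Proof. intros [H| ->]; [left; now apply exp_increasing|apply Rle_refl]. Qed.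

(** Stands in for integrating an inequality of derivatives; it makes integrals of
    complex functions unnecessary. *)
Lemma derivative_comparison (phi psi dphi dpsi : R -> R) (x y : R) :
  x <= y ->
  (forall t, x <= t <= y -> is_derive phi t (dphi t)) ->
  (forall t, x <= t <= y -> is_derive psi t (dpsi t)) ->
  (forall t, x <= t <= y -> dphi t <= dpsi t) ->
  phi y - phi x <= psi y - psi x.
Proof.
  intros Hxy H1 H2 Hle.
  assert (HD : forall t, x <= t <= y ->
            is_derive (fun s => psi s - phi s) t (dpsi t - dphi t)).
  { intros t Ht. apply (is_derive_minus psi phi); auto. }
  destruct (MVT_gen (fun s => psi s - phi s) x y (fun t => dpsi t - dphi t))
    as [c [Hc E]]; rewrite ?Rmin_left, ?Rmax_right in * by exact Hxy.
  - intros t Ht. apply HD. lra.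
  - intros t Ht. apply derivable_continuous_pt.
    eexists. apply is_derive_Reals, HD, Ht.
  - specialize (Hle c Hc).
    assert (0 <= (dpsi c - dphi c) * (y - x)) by (apply Rmult_le_pos; lra).
    lra.
Qed.

(** The factor [u] selects a component: [u = 1] gives the real part, [u = - Ci] the
    imaginary part, and the conjugate of a unit number the component along it. *)
Lemma is_derive_along_ray (F : C -> C) (u zeta l : C) (t : R) :
  Cmod zeta = 1 -> cdiff F (t * zeta) l ->
  is_derive (fun s : R => fst (u * F (s * zeta))%C) t (fst (u * (l * zeta))%C).
Proof.
  intros Hz HF. apply is_derive_Reals. intros eps Heps.
  pose proof (Cmod_ge_0 u) as Hu.
  assert (He : 0 < eps / (Cmod u + 1)) by (apply Rdiv_lt_0_compat; lra).
  destruct (HF _ He) as [d [Hd HFd]].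
  exists (mkposreal d Hd). intros k Hk Hkd. simpl in Hkd.
  assert (E : ((t + k)%R * zeta - t * zeta = k * zeta)%C) by (rewrite RtoC_plus; ring).
  specialize (HFd ((t + k)%R * zeta)%C). rewrite E, Cmod_mult, Hz, Cmod_R, Rmult_1_r in HFd.
  specialize (HFd Hkd).
  set (X := (F ((t + k)%R * zeta) - F (t * zeta) - l * (k * zeta))%C) in *.
  replace ((fst (u * F ((t + k)%R * zeta)%C)%C - fst (u * F (t * zeta)%C)%C) / k
            - fst (u * (l * zeta))%C) with (fst (u * X)%C / k).
  - unfold Rdiv. rewrite Rabs_mult, Rabs_inv.
    assert (0 < Rabs k) by now apply Rabs_pos_lt.
    apply (Rmult_lt_reg_r (Rabs k)); [assumption|].
    rewrite Rmult_assoc, Rinv_l, Rmult_1_r by lra.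
    eapply Rle_lt_trans; [apply re_le_Cmod|]. rewrite Cmod_mult.
    apply (Rmult_le_compat_l _ _ _ Hu) in HFd.
    eapply Rle_lt_trans; [exact HFd|].
    rewrite <- Rmult_assoc. apply Rmult_lt_compat_r; [assumption|].
    apply (Rmult_lt_reg_r (Cmod u + 1)); [lra|].
    replace (Cmod u * (eps / (Cmod u + 1)) * (Cmod u + 1)) with (Cmod u * eps) by (field; lra).
    nra.
  - unfold X.
    set (F1 := F ((t + k)%R * zeta)%C). set (F0 := F (t * zeta)%C).
    destruct u, F1, F0, l, zeta; simpl. field. exact Hk.
Qed.

Lemma polar_form (z : C) : exists zeta : C, Cmod zeta = 1 /\ z = (Cmod z * zeta)%C.
Proof.
  destruct (Req_dec (Cmod z) 0) as [H|H].
  - exists (RtoC 1). split; [apply Cmod_1|]. rewrite H. rewrite (Cmod_eq_0 z H). ring.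
  - assert (H' : RtoC (Cmod z) <> 0) by (intros E; apply H; now injection E).
    exists (z / Cmod z)%C. split.
    + rewrite Cmod_div, Cmod_R, Rabs_pos_eq by (exact H' || apply Cmod_ge_0). now field.
    + field. exact H'.
Qed.

Lemma ray_in_disk (zeta : C) (t r : R) :
  Cmod zeta = 1 -> r < 1 -> 0 <= t <= r ->
  Cmod (t * zeta) = t /\ in_disk (t * zeta).
Proof.
  intros Hz Hr Ht.
  assert (E : Cmod (t * zeta) = t) by (rewrite Cmod_mult, Hz, Cmod_R, Rabs_pos_eq; lra).
  split; [exact E|]. unfold in_disk. rewrite E. lra.
Qed.

Lemma ln_ratio_derive (t : R) : -1 < t < 1 ->
  is_derive (fun s => ln ((1 + s) / (1 - s))) t (2 / (1 - t ^ 2)).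
Proof.
  intros Ht.
  assert (0 < (1 + t) / (1 - t)) by (apply Rdiv_lt_0_compat; lra).
  auto_derive.
  - repeat split; [lra|]. exact H.
  - field. repeat split; nra.
Qed.

(** [(ln |q|^2)' = 2 Re (q' zeta / q)] along the ray, so the pre-Schwarzian bound
    controls it by [2 lambda] times the derivative of [ln ((1 + t) / (1 - t))]. *)
Lemma ln_modulus_derive (q dq : C -> C) (lambda : R) (zeta : C) (t : R) :
  (forall w, in_disk w -> cdiff q w (dq w)) ->
  (forall w, in_disk w -> q w <> 0) ->
  (forall w, in_disk w -> (1 - Cmod w ^ 2) * Cmod (dq w / q w) <= 2 * lambda) ->
  Cmod zeta = 1 -> 0 <= t < 1 ->
  exists l, is_derive (fun s : R => ln (Cmod (q (s * zeta)%C) ^ 2)) t l /\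
            Rabs l <= 2 * lambda * (2 / (1 - t ^ 2)).
Proof.
  intros q_diff q_neq0 q_bound Hz Ht.
  destruct (ray_in_disk zeta t t Hz) as [Et Hd]; [lra|lra|].
  set (z := (t * zeta)%C) in *.
  pose proof (is_derive_along_ray q 1 zeta (dq z) t Hz (q_diff z Hd)) as D1.
  pose proof (is_derive_along_ray q (- Ci) zeta (dq z) t Hz (q_diff z Hd)) as D2.
  pose proof (q_neq0 z Hd) as Hq. pose proof (q_bound z Hd) as Hb.
  assert (Hq0 : 0 < Cmod (q z)) by now apply Cmod_gt_0.
  exists (2 * fst (Cconj (q z) * (dq z * zeta))%C / Cmod (q z) ^ 2).
  split.
  - apply (is_derive_ext (fun s : R => ln (fst (1 * q (s * zeta)%C)%C ^ 2
              + fst (- Ci * q (s * zeta)%C)%C ^ 2))).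
    { intros s. rewrite Cmod2_alt. f_equal. unfold Re, Im, Ci.
      destruct (q (s * zeta)%C); simpl. ring. }
    assert (EN : fst (1 * q z)%C ^ 2 + fst (- Ci * q z)%C ^ 2 = Cmod (q z) ^ 2).
    { rewrite Cmod2_alt. unfold Re, Im, Ci. destruct (q z); simpl. ring. }
    evar_last.
    + apply (is_derive_comp ln (fun s : R => fst (1 * q (s * zeta)%C)%C ^ 2
              + fst (- Ci * q (s * zeta)%C)%C ^ 2)).
      * apply is_derive_ln. fold z. rewrite EN. now apply pow_lt.
      * apply (is_derive_plus (K := R_AbsRing) (V := R_NormedModule)).
        -- apply (is_derive_pow _ 2 _ _ D1).
        -- apply (is_derive_pow _ 2 _ _ D2).
    + fold z. unfold scal, plus; simpl; unfold mult; simpl.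
      simpl in EN. rewrite EN. unfold Ci, Cconj.
      destruct (q z), (dq z), zeta; simpl. field.
      apply Rgt_not_eq. exact Hq0.
  - unfold Rdiv. rewrite !Rabs_mult, (Rabs_pos_eq 2), Rabs_inv, (Rabs_pos_eq (Cmod (q z) ^ 2))
      by (try apply pow2_ge_0; lra).
    assert (Hc : Rabs (fst (Cconj (q z) * (dq z * zeta))%C) <= Cmod (q z) * Cmod (dq z)).
    { eapply Rle_trans; [apply re_le_Cmod|].
      rewrite !Cmod_mult, Cmod_conj, Hz. lra. }
    rewrite Cmod_div, Et in Hb by exact Hq.
    assert (Ht2 : 0 < 1 - t ^ 2) by nra.
    apply Rle_trans with (2 * (Cmod (dq z) / Cmod (q z))).
    + apply (Rmult_le_reg_r (Cmod (q z) ^ 2)); [now apply pow_lt|].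
      match goal with |- ?a <= ?b =>
        replace a with (2 * Rabs (fst (Cconj (q z) * (dq z * zeta))%C)) by (field; lra);
        replace b with (2 * (Cmod (q z) * Cmod (dq z))) by (field; lra) end.
      lra.
    + apply (Rmult_le_reg_l (1 - t ^ 2)); [exact Ht2|].
      replace ((1 - t ^ 2) * (2 * lambda * (2 * / (1 - t ^ 2)))) with (4 * lambda)
        by (field; lra).
      lra.
Qed.

(** Comparison of [ln |q|^2] along the radius to [z] with
    [2 lambda ln ((1 + t) / (1 - t))], applied to both signs; exponentiating turns
    the right-hand side into [H_integrand]. *)
Lemma modulus_bounds (q dq : C -> C) (lambda : R) (z : C) :
  (forall w, in_disk w -> cdiff q w (dq w)) ->
  (forall w, in_disk w -> q w <> 0) ->
  (forall w, in_disk w -> (1 - Cmod w ^ 2) * Cmod (dq w / q w) <= 2 * lambda) ->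
  in_disk z ->
  Cmod (q 0) * H_integrand lambda (- Cmod z) <= Cmod (q z)
    <= Cmod (q 0) * H_integrand lambda (Cmod z).
Proof.
  intros q_diff q_neq0 q_bound Hd. destruct (polar_form z) as [zeta [Hz Ez]].
  unfold in_disk in Hd. pose proof (Cmod_ge_0 z) as Hr. set (r := Cmod z) in *.
  set (phi := fun s : R => ln (Cmod (q (s * zeta)%C) ^ 2)).
  set (psi := fun s : R => 2 * lambda * ln ((1 + s) / (1 - s))).
  set (dphi := Derive phi).
  set (dpsi := fun t : R => 2 * lambda * (2 / (1 - t ^ 2))).
  assert (HL : forall t, 0 <= t <= r -> is_derive phi t (dphi t) /\ Rabs (dphi t) <= dpsi t).
  { intros t Ht. destruct (ln_modulus_derive q dq lambda zeta t q_diff q_neq0 q_bound Hz)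
      as [l [H1 H2]]; [lra|].
    replace (dphi t) with l by (symmetry; exact (is_derive_unique _ _ _ H1)). now split. }
  assert (HP : forall t, 0 <= t <= r -> is_derive psi t (dpsi t)).
  { intros t Ht. apply (is_derive_scal (fun s => ln ((1 + s) / (1 - s)))).
    apply ln_ratio_derive. lra. }
  assert (U : phi r - phi 0 <= psi r - psi 0).
  { apply (derivative_comparison phi psi dphi dpsi); auto.
    - intros t Ht. now apply HL.
    - intros t Ht. destruct (HL t Ht) as [_ H]. pose proof (Rle_abs (dphi t)). lra. }
  assert (L : - phi r - - phi 0 <= psi r - psi 0).
  { apply (derivative_comparison (fun t => - phi t) psi (fun t => - dphi t) dpsi); auto.
    - intros t Ht. apply (is_derive_opp phi). now apply HL.
    - intros t Ht. destruct (HL t Ht) as [_ H]. pose proof (Rle_abs (- dphi t)).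
      rewrite Rabs_Ropp in H0. lra. }
  unfold phi, psi in U, L.
  rewrite <- Ez in U, L. replace (0 * zeta)%C with (RtoC 0) in U, L by ring.
  replace ((1 + 0) / (1 - 0)) with 1 in U, L by field. rewrite ln_1 in U, L.
  assert (Hq0 : 0 < Cmod (q 0)).
  { apply Cmod_gt_0, q_neq0. unfold in_disk. rewrite Cmod_0. lra. }
  assert (Hqz : 0 < Cmod (q z)) by now apply Cmod_gt_0, q_neq0.
  simpl in U, L. rewrite !Rmult_1_r, !ln_mult in U, L by assumption.
  set (x := ln ((1 + r) / (1 - r))) in *.
  assert (Hx : ln ((1 + - r) / (1 - - r)) = - x).
  { unfold x. rewrite <- ln_Rinv by (apply Rdiv_lt_0_compat; lra). f_equal. field. lra. }
  unfold H_integrand, Rpower. rewrite Hx. fold x.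
  rewrite <- (exp_ln _ Hq0), <- (exp_ln _ Hqz), <- !exp_plus.
  split; apply exp_monotone; lra.
Qed.

(** * Distortion of the rotated derivatives *)

Lemma cis_surjective (c : C) : Cmod c = 1 ->
  exists theta, 0 <= theta <= 2 * PI /\ cis theta = c.
Proof.
  intros H. destruct c as [x y].
  assert (E : x ^ 2 + y ^ 2 = 1).
  { pose proof (Cmod2_alt (x, y)) as H'. rewrite H in H'. simpl in *. lra. }
  assert (Hx : -1 <= x <= 1) by nra.
  pose proof (acos_bound x) as HB.
  assert (Es : sin (acos x) = Rabs y).
  { rewrite sin_acos by exact Hx. rewrite <- sqrt_Rsqr_abs. f_equal. unfold Rsqr. nra. }
  destruct (Rle_dec 0 y) as [Hy|Hy].
  - exists (acos x). split; [lra|]. unfold cis. rewrite cos_acos, Es, Rabs_pos_eq by lra. reflexivity.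
  - exists (2 * PI - acos x). split; [lra|]. unfold cis.
    rewrite cos_minus, sin_minus, cos_2PI, sin_2PI, cos_acos, Es, Rabs_left by lra.
    f_equal; ring.
Qed.

(** A unit factor on [B] can give it the direction of [A] ([s = 1]) or the opposite
    one ([s = -1]). This is how bounds valid for every rotation [theta] become
    bounds for the sum and the difference of the moduli. *)
Lemma aligning_rotation (A B : C) (s : R) : Rabs s = 1 ->
  exists theta, 0 <= theta <= 2 * PI /\
    Cmod (A + cis theta * B) = Rabs (Cmod A + s * Cmod B).
Proof.
  intros Hs.
  destruct (polar_form A) as [a [Ha EA]]. destruct (polar_form B) as [b [Hb EB]].
  assert (Hb0 : b <> 0) by (apply Cmod_gt_0; lra).
  destruct (cis_surjective (s * (a / b))%C) as [theta [Ht E]].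
  { rewrite Cmod_mult, Cmod_div, Cmod_R, Hs, Ha, Hb by exact Hb0. field. }
  exists theta. split; [exact Ht|]. rewrite E.
  transitivity (Cmod ((Cmod A + s * Cmod B)%R * a)).
  - f_equal. rewrite EA at 1. rewrite EB at 1. rewrite RtoC_plus, RtoC_mult. field. exact Hb0.
  - rewrite Cmod_mult, Ha, Cmod_R. ring.
Qed.

Lemma cdiff_add_scal (f1 f2 : C -> C) (c z l1 l2 : C) :
  cdiff f1 z l1 -> cdiff f2 z l2 ->
  cdiff (fun w => f1 w + c * f2 w)%C z (l1 + c * l2)%C.
Proof.
  intros H1 H2. apply is_derive_cdiff in H1. apply is_derive_cdiff in H2.
  apply is_derive_cdiff.
  apply (is_derive_plus (K := C_AbsRing) (V := C_NormedModule)); [exact H1|].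
  pose proof (filterdiff_scal_r_fct (K := C_AbsRing) (U := AbsRing_NormedModule C_AbsRing)
    (V := C_NormedModule) c f2 _ Cmult_comm H2) as H.
  eapply filterdiff_ext_lin; [exact H|].
  intros y. unfold scal; simpl; unfold mult; simpl. ring.
Qed.

Lemma class_BH_nonvanishing (lambda : R) (h g : C -> C) (z : C) (theta : R) :
  class_BH lambda h g -> in_disk z -> 0 <= theta <= 2 * PI ->
  rotated_derive h g theta z <> 0.
Proof.
  intros [_ H] Hz Ht E. unfold preSchwarzian_norm in H.
  destruct ClassicalDescription.excluded_middle_informative as [V|V]; [exact H|].
  apply V. now exists z, theta.
Qed.

Lemma class_BH_bound (lambda : R) (h g : C -> C) (z : C) (theta : R) :
  class_BH lambda h g -> in_disk z -> 0 <= theta <= 2 * PI ->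
  (1 - Cmod z ^ 2) *
    Cmod (rotated_derive2 h g theta z / rotated_derive h g theta z) <= 2 * lambda.
Proof.
  intros [_ H] Hz Ht. unfold preSchwarzian_norm in H.
  destruct ClassicalDescription.excluded_middle_informative as [V|V]; [contradiction|].
  destruct (Lub_Rbar_correct (preSchwarzian_values h g)) as [Hub _].
  change (Rbar_le ((1 - Cmod z ^ 2) *
    Cmod (rotated_derive2 h g theta z / rotated_derive h g theta z)) (2 * lambda)).
  eapply Rbar_le_trans; [|exact H]. apply Hub. now exists z, theta.
Qed.

(** [modulus_bounds] for [h' + e^(i theta) g'], uniformly in [theta]. *)
Lemma distortion (lambda : R) (h g : C -> C) (a b : nat -> C) (z : C) (theta : R) :
  represents a h -> represents b g -> class_BH lambda h g ->
  in_disk z -> 0 <= theta <= 2 * PI ->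
  Cmod (rotated_derive h g theta 0) * H_integrand lambda (- Cmod z)
    <= Cmod (rotated_derive h g theta z)
    <= Cmod (rotated_derive h g theta 0) * H_integrand lambda (Cmod z).
Proof.
  intros Ha Hb HB Hz Ht.
  apply (modulus_bounds (rotated_derive h g theta) (rotated_derive2 h g theta) lambda).
  - intros w Hw.
    apply (cdiff_add_scal (C_derive h) (C_derive g)).
    + exact (represents_cdiff _ _ w (represents_derive _ _ Ha) Hw).
    + exact (represents_cdiff _ _ w (represents_derive _ _ Hb) Hw).
  - intros w Hw. now apply (class_BH_nonvanishing lambda).
  - intros w Hw. now apply class_BH_bound.
  - exact Hz.
Qed.

(** The norm of the differential of [f] is [|h'| + |g'|]: choose the rotation that
    aligns the two derivatives. *)
Lemma sum_derivatives_bound (lambda : R) (h g : C -> C) (a b : nat -> C) (z : C) :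
  represents a h -> represents b g -> class_BH lambda h g -> in_disk z ->
  Cmod (C_derive h z) + Cmod (C_derive g z)
    <= (1 + Cmod (C_derive g 0)) * H_integrand lambda (Cmod z).
Proof.
  intros Ha Hb HB Hz.
  destruct (aligning_rotation (C_derive h z) (C_derive g z) 1) as [theta [Ht E]];
    [apply Rabs_R1|].
  rewrite Rmult_1_l, Rabs_pos_eq in E
    by (apply Rplus_le_le_0_compat; apply Cmod_ge_0).
  rewrite <- E.
  eapply Rle_trans; [apply (distortion lambda h g a b z theta); assumption|].
  apply Rmult_le_compat_r; [left; apply exp_pos|].
  unfold rotated_derive. eapply Rle_trans; [apply Cmod_triangle|].
  rewrite Cmod_mult.
  assert (Ec : Cmod (cis theta) = 1).
  { unfold Cmod, cis; simpl. rewrite !Rmult_1_r.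
    pose proof (sin2_cos2 theta) as S. unfold Rsqr in S.
    rewrite Rplus_comm, S. apply sqrt_1. }
  destruct HB as [[_ [_ [_ [_ E1]]]] _]. rewrite E1, Ec, Cmod_1. lra.
Qed.

(** The differential of [f] stretches every vector by at least [|h'| - |g'|]: choose
    the rotation that opposes the two derivatives. At the origin the rotated
    derivative is 1 because [g' 0 = 0]. *)
Lemma diff_derivatives_bound (lambda : R) (h g : C -> C) (a b : nat -> C) (z : C) :
  represents a h -> represents b g -> class_BH lambda h g ->
  sense_preserving h g -> C_derive g 0 = 0 -> in_disk z ->
  H_integrand lambda (- Cmod z) <= Cmod (C_derive h z) - Cmod (C_derive g z).
Proof.
  intros Ha Hb HB Hs Hg Hz.
  destruct (aligning_rotation (C_derive h z) (C_derive g z) (-1)) as [theta [Ht E]].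
  { rewrite Rabs_left; lra. }
  specialize (Hs z Hz).
  rewrite Rabs_pos_eq in E by lra.
  replace (Cmod (C_derive h z) - Cmod (C_derive g z))
    with (Cmod (rotated_derive h g theta z)) by (unfold rotated_derive; rewrite E; ring).
  eapply Rle_trans; [|apply (distortion lambda h g a b z theta); assumption].
  unfold rotated_derive at 1. rewrite Hg. destruct HB as [[_ [_ [_ [_ E1]]]] _].
  rewrite E1. replace (1 + cis theta * 0)%C with (RtoC 1) by ring.
  rewrite Cmod_1. lra.
Qed.

(** * The function H and its limits at 1 and -1 *)

Definition H_fun (lambda x : R) : R := RInt (H_integrand lambda) 0 x.

Lemma H_integrand_continuous (lambda t : R) : -1 < t < 1 ->
  continuous (H_integrand lambda) t.
Proof.
  intros Ht. apply (ex_derive_continuous (K := R_AbsRing) (V := R_NormedModule)).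
  unfold H_integrand, Rpower.
  assert (0 < (1 + t) / (1 - t)) by (apply Rdiv_lt_0_compat; lra).
  auto_derive. repeat split; [lra|exact H].
Qed.

Lemma H_fun_is_RInt (lambda x : R) : -1 < x < 1 ->
  is_RInt (H_integrand lambda) 0 x (H_fun lambda x).
Proof.
  intros Hx. apply (RInt_correct (V := R_CompleteNormedModule)).
  apply (ex_RInt_continuous (V := R_CompleteNormedModule)).
  intros t Ht. apply H_integrand_continuous.
  unfold Rmin, Rmax in Ht. destruct (Rle_dec 0 x); lra.
Qed.

Lemma H_fun_derive (lambda x : R) : -1 < x < 1 ->
  is_derive (H_fun lambda) x (H_integrand lambda x).
Proof.
  intros Hx. apply (is_derive_RInt _ _ 0); [|now apply H_integrand_continuous].
  assert (Hd : 0 < Rmin (x + 1) (1 - x)) by (apply Rmin_pos; lra).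
  exists (mkposreal _ Hd). intros y Hy. apply H_fun_is_RInt.
  unfold ball in Hy; simpl in Hy. unfold AbsRing_ball, abs, minus, plus, opp in Hy; simpl in Hy.
  pose proof (Rmin_l (x + 1) (1 - x)). pose proof (Rmin_r (x + 1) (1 - x)).
  apply Rabs_def2 in Hy. lra.
Qed.

Lemma H_fun_0 (lambda : R) : H_fun lambda 0 = 0.
Proof. apply (RInt_point (V := R_CompleteNormedModule) 0 (H_integrand lambda)). Qed.

Lemma H_integrand_pos (lambda t : R) : 0 < H_integrand lambda t.
Proof. apply exp_pos. Qed.

Lemma H_integrand_monotone (lambda s t : R) : 0 <= lambda -> -1 < s -> s <= t -> t < 1 ->
  H_integrand lambda s <= H_integrand lambda t.
Proof.
  intros Hl Hs Hst Ht. unfold H_integrand.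
  apply exp_monotone, Rmult_le_compat_l; [exact Hl|].
  apply ln_le; [apply Rdiv_lt_0_compat; lra|].
  apply (Rmult_le_reg_r ((1 - s) * (1 - t))); [nra|].
  replace ((1 + s) / (1 - s) * ((1 - s) * (1 - t))) with ((1 + s) * (1 - t)) by (field; lra).
  replace ((1 + t) / (1 - t) * ((1 - s) * (1 - t))) with ((1 + t) * (1 - s)) by (field; lra).
  nra.
Qed.

Lemma H_integrand_0 (lambda : R) : H_integrand lambda 0 = 1.
Proof.
  unfold H_integrand, Rpower. replace ((1 + 0) / (1 - 0)) with 1 by field.
  now rewrite ln_1, Rmult_0_r, exp_0.
Qed.

(** Shared by both endpoints: the behaviour at [-1] is brought to the left of 1 by
    reflection. *)
Lemma monotone_bounded_limit (phi : R -> R) (B : R) :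
  (forall x y, 0 <= x -> x <= y -> y < 1 -> phi x <= phi y) ->
  (forall x, 0 <= x < 1 -> phi x <= B) ->
  exists l, (forall x, 0 <= x < 1 -> phi x <= l) /\ filterlim phi (at_left 1) (locally l).
Proof.
  intros Hm HB.
  destruct (completeness (fun y => exists x, 0 <= x < 1 /\ y = phi x)) as [l [Hu Hl]].
  - exists B. intros y [x [Hx ->]]. now apply HB.
  - exists (phi 0), 0. split; [lra|reflexivity].
  - assert (Hle : forall x, 0 <= x < 1 -> phi x <= l) by (intros x Hx; apply Hu; now exists x).
    exists l. split; [exact Hle|].
    apply filterlim_locally. intros eps. pose proof (cond_pos eps) as He.
    assert (Hx0 : exists x0, 0 <= x0 < 1 /\ l - eps < phi x0).
    { apply NNPP. intros Hn. assert (l <= l - eps); [|lra].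
      apply Hl. intros y [x [Hx ->]]. apply Rnot_lt_le. intros Hlt. apply Hn. now exists x. }
    destruct Hx0 as [x0 [Hx0 Hx1]].
    assert (Hd : 0 < 1 - x0) by lra.
    exists (mkposreal _ Hd). intros x Hx Hlt.
    unfold ball in *; simpl in *. unfold AbsRing_ball, abs, minus, plus, opp in *; simpl in *.
    apply Rabs_def2 in Hx.
    assert (phi x0 <= phi x) by (apply Hm; lra).
    assert (phi x <= l) by (apply Hle; lra).
    apply Rabs_def1; lra.
Qed.

Lemma H_improper (lambda l : R) (F : (R -> Prop) -> Prop) (FF : ProperFilter F) :
  F (fun x => -1 < x < 1) -> filterlim (H_fun lambda) F (locally l) ->
  RInt_gen (H_integrand lambda) (at_point 0) F = l.
Proof.
  intros HF Hl.
  apply (is_RInt_gen_unique (V := R_CompleteNormedModule)).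
  intros Q HQ. specialize (Hl Q HQ).
  apply (Filter_prod _ _ _ (fun x => x = 0) (fun x => -1 < x < 1 /\ Q (H_fun lambda x))).
  - reflexivity.
  - now apply filter_and.
  - intros x y -> [Hy HQy]. exists (H_fun lambda y). split; [|exact HQy].
    now apply H_fun_is_RInt.
Qed.

Lemma H_fun_monotone (lambda x y : R) : -1 < x -> x <= y -> y < 1 ->
  H_fun lambda x <= H_fun lambda y.
Proof.
  intros Hx Hxy Hy.
  pose proof (derivative_comparison (fun _ => 0) (H_fun lambda) (fun _ => 0)
    (H_integrand lambda) x y Hxy) as H.
  cut (0 - 0 <= H_fun lambda y - H_fun lambda x); [lra|]. apply H.
  - intros t _. apply (is_derive_const (K := R_AbsRing) (V := R_NormedModule)).
  - intros t Ht. apply H_fun_derive. lra.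
  - intros t _. left. apply H_integrand_pos.
Qed.

(** [(1 + t) / (1 - t) <= 2 / (1 - t)], and the power of [2 / (1 - t)] has an explicit
    primitive. The same formula gives the growth order for [lambda > 1] and the
    convergence at 1 for [lambda < 1]. *)
Lemma H_fun_upper (lambda r : R) : 0 <= lambda -> lambda <> 1 -> 0 <= r < 1 ->
  H_fun lambda r <= Rpower 2 lambda / (1 - lambda) * (1 - Rpower (1 - r) (1 - lambda)).
Proof.
  intros Hl Hl1 Hr.
  set (K := fun t => - (Rpower 2 lambda / (1 - lambda)) * Rpower (1 - t) (1 - lambda)).
  cut (H_fun lambda r - H_fun lambda 0 <= K r - K 0).
  { rewrite H_fun_0. unfold K. rewrite Rminus_0_r with (r := 1).
    assert (E : Rpower 1 (1 - lambda) = 1) by (unfold Rpower; now rewrite ln_1, Rmult_0_r, exp_0).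
    rewrite E. lra. }
  apply (derivative_comparison (H_fun lambda) K (H_integrand lambda)
          (fun t => Rpower 2 lambda * Rpower (1 - t) (- lambda))); [lra| | |].
  - intros t Ht. apply H_fun_derive. lra.
  - intros t Ht. unfold K, Rpower. auto_derive; [lra|].
    replace ((1 - lambda) * ln (1 + - t)) with (ln (1 - t) + - lambda * ln (1 - t))
      by (unfold Rminus; ring).
    rewrite exp_plus, exp_ln by lra. field. lra.
  - intros t Ht. unfold H_integrand, Rpower. rewrite <- exp_plus.
    apply exp_monotone.
    unfold Rdiv at 1. rewrite ln_mult by (try apply Rinv_0_lt_compat; lra).
    rewrite ln_Rinv by lra.
    assert (ln (1 + t) <= ln 2) by (apply ln_le; lra). nra.
Qed.

Lemma H_fun_le_H_at_1 (lambda : R) : 0 <= lambda < 1 ->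
  forall r, 0 <= r < 1 -> H_fun lambda r <= H_at_1 lambda.
Proof.
  intros Hl.
  destruct (monotone_bounded_limit (H_fun lambda) (Rpower 2 lambda / (1 - lambda)))
    as [l [Hle Hlim]].
  - intros x y Hx Hxy Hy. apply H_fun_monotone; lra.
  - intros x Hx. eapply Rle_trans; [apply H_fun_upper; lra|].
    assert (0 < Rpower 2 lambda / (1 - lambda)) by (apply Rdiv_lt_0_compat; [apply exp_pos|lra]).
    assert (0 < Rpower (1 - x) (1 - lambda)) by apply exp_pos. nra.
  - unfold H_at_1. rewrite (H_improper lambda l); [exact Hle| apply at_left_proper_filter | |exact Hlim].
    exists (mkposreal 1 Rlt_0_1). intros y Hy Hy1.
    unfold ball in *; simpl in *. unfold AbsRing_ball, abs, minus, plus, opp in *; simpl in *.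
    apply Rabs_def2 in Hy. lra.
Qed.

(** This is the integral of [((1 - s) / (1 + s)) ^ lambda] for [s] from 0 to [x]; it
    tends to [- H_at_m1 lambda] as [x] tends to 1. *)
Definition H_refl (lambda x : R) : R := - H_fun lambda (- x).

Lemma H_refl_derive (lambda x : R) : -1 < x < 1 ->
  is_derive (H_refl lambda) x (H_integrand lambda (- x)).
Proof.
  intros Hx. unfold H_refl.
  evar_last.
  - apply (is_derive_opp (fun y => H_fun lambda (- y))).
    apply (is_derive_comp (H_fun lambda) Ropp); [apply H_fun_derive; lra|].
    instantiate (1 := -1). auto_derive; [exact I|ring].
  - unfold opp, scal; simpl; unfold mult; simpl. ring.
Qed.

Lemma H_refl_monotone (lambda x y : R) : -1 < x -> x <= y -> y < 1 ->
  H_refl lambda x <= H_refl lambda y.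
Proof.
  intros Hx Hxy Hy. unfold H_refl.
  assert (H_fun lambda (- y) <= H_fun lambda (- x)) by (apply H_fun_monotone; lra). lra.
Qed.

(** The derivative [H_integrand lambda (- t)] decreases, so the graph lies below its
    tangents. *)
Lemma H_refl_concave (lambda x y : R) : 0 <= lambda -> -1 < x -> x <= y -> y < 1 ->
  H_refl lambda y <= H_refl lambda x + H_integrand lambda (- x) * (y - x).
Proof.
  intros Hl Hx Hxy Hy.
  set (k := H_integrand lambda (- x)).
  cut (H_refl lambda y - H_refl lambda x <= k * y - k * x); [lra|].
  apply (derivative_comparison (H_refl lambda) (fun t => k * t)
           (fun t => H_integrand lambda (- t)) (fun _ => k)); [exact Hxy| | |].
  - intros t Ht. apply H_refl_derive. lra.
  - intros t Ht. auto_derive; [exact I|ring].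
  - intros t Ht. apply H_integrand_monotone; lra.
Qed.

Lemma H_refl_0 (lambda : R) : H_refl lambda 0 = 0.
Proof. unfold H_refl. rewrite Ropp_0, H_fun_0. ring. Qed.

Lemma H_at_m1_approx (lambda y : R) : 0 <= lambda -> y < - H_at_m1 lambda ->
  exists rho, 0 <= rho < 1 /\ y < H_refl lambda rho.
Proof.
  intros Hl Hy.
  destruct (monotone_bounded_limit (H_refl lambda) 1) as [l [Hle Hlim]].
  - intros x z Hx Hxz Hz. apply H_refl_monotone; lra.
  - intros x Hx. pose proof (H_refl_concave lambda 0 x Hl) as H.
    rewrite H_refl_0, Ropp_0, H_integrand_0 in H. lra.
  - assert (El : H_at_m1 lambda = - l).
    { apply (H_improper lambda (- l)); [apply at_right_proper_filter| |].
      - exists (mkposreal 1 Rlt_0_1). intros x Hx Hx1.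
        unfold ball in *; simpl in *. unfold AbsRing_ball, abs, minus, plus, opp in *; simpl in *.
        apply Rabs_def2 in Hx. lra.
      - apply filterlim_locally. intros eps.
        destruct (proj1 (filterlim_locally _ _) Hlim eps) as [d Hd].
        exists d. intros x Hx Hx1. specialize (Hd (- x)).
        unfold ball in *; simpl in *. unfold AbsRing_ball, abs, minus, plus, opp in *; simpl in *.
        unfold H_refl in Hd. rewrite Ropp_involutive in Hd.
        replace (H_fun lambda x + - - l) with (- (- H_fun lambda x + - l)) by ring.
        rewrite Rabs_Ropp. apply Hd; [|lra].
        replace (- x + - (1)) with (- (x + - -1)) by ring. now rewrite Rabs_Ropp. }
    rewrite El in Hy. clear Hle.
    assert (He : 0 < l - y) by lra.
    destruct (proj1 (filterlim_locally _ _) Hlim (mkposreal _ He)) as [d Hd].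
    pose proof (cond_pos d) as Hd0.
    set (rho := Rmax 0 (1 - d / 2)).
    assert (H1 : 0 <= rho) by apply Rmax_l.
    assert (H2 : 1 - d / 2 <= rho) by apply Rmax_r.
    assert (H3 : rho < 1) by (apply Rmax_lub_lt; lra).
    exists rho. split; [lra|].
    specialize (Hd rho).
    unfold ball in *; simpl in *. unfold AbsRing_ball, abs, minus, plus, opp in *; simpl in *.
    assert (Hlt : Rabs (H_refl lambda rho + - l) < l - y).
    { apply Hd; [apply Rabs_def1; lra|exact H3]. }
    apply Rabs_def2 in Hlt. lra.
Qed.

(** * Growth *)

(** Differentiate along the radius the component of [f] in the direction of [f z]:
    its rate is at most [|h'| + |g'|]. *)
Lemma growth_bound (lambda : R) (h g : C -> C) (a b : nat -> C) (z : C) :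
  represents a h -> represents b g -> class_BH lambda h g -> in_disk z ->
  Cmod (harmonic_map h g z) <= (1 + Cmod (C_derive g 0)) * H_fun lambda (Cmod z).
Proof.
  intros Ha Hb HB Hz.
  destruct (polar_form z) as [zeta [Hzeta Ez]].
  destruct (polar_form (harmonic_map h g z)) as [e [He Ef]].
  unfold in_disk in Hz. pose proof (Cmod_ge_0 z) as Hr.
  set (r := Cmod z) in *. set (M := 1 + Cmod (C_derive g 0)).
  (* The real part of conj e * f, rewritten so that only analytic functions occur:
     Re (conj e * conj g) = Re (e * g). *)
  set (phi := fun t : R => fst (Cconj e * h (t * zeta)%C)%C + fst (e * g (t * zeta)%C)%C).
  set (dphi := fun t : R => fst (Cconj e * (C_derive h (t * zeta) * zeta))%C
                          + fst (e * (C_derive g (t * zeta) * zeta))%C).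
  assert (Hray : forall t, 0 <= t <= r -> Cmod (t * zeta) = t /\ in_disk (t * zeta))
    by (intros t Ht; now apply (ray_in_disk zeta t r)).
  assert (K : phi r - phi 0 <= M * H_fun lambda r - M * H_fun lambda 0).
  { apply (derivative_comparison phi (fun t => M * H_fun lambda t) dphi
             (fun t => M * H_integrand lambda t)); [exact Hr| | |].
    - intros t Ht. destruct (Hray t Ht) as [_ Hd].
      apply (is_derive_plus (K := R_AbsRing) (V := R_NormedModule)).
      + apply is_derive_along_ray; [exact Hzeta|]. now apply (represents_cdiff a).
      + apply is_derive_along_ray; [exact Hzeta|]. now apply (represents_cdiff b).
    - intros t Ht. apply (is_derive_scal (H_fun lambda)). apply H_fun_derive. lra.
    - intros t Ht. destruct (Hray t Ht) as [Et Hd].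
      pose proof (sum_derivatives_bound lambda h g a b _ Ha Hb HB Hd) as S.
      rewrite Et in S. eapply Rle_trans; [|exact S]. unfold dphi.
      apply Rplus_le_compat.
      + eapply Rle_trans; [apply Rle_abs|]. eapply Rle_trans; [apply re_le_Cmod|].
        rewrite !Cmod_mult, Cmod_conj, He, Hzeta. lra.
      + eapply Rle_trans; [apply Rle_abs|]. eapply Rle_trans; [apply re_le_Cmod|].
        rewrite !Cmod_mult, He, Hzeta. lra. }
  rewrite H_fun_0 in K. unfold phi in K. rewrite <- Ez in K.
  destruct HB as [[_ [_ [h0 [g0 _]]]] _].
  replace (0 * zeta)%C with (RtoC 0) in K by ring. rewrite h0, g0 in K.
  assert (E0 : fst (Cconj e * 0)%C + fst (e * 0)%C = 0) by (destruct e; simpl; ring).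
  rewrite E0 in K.
  assert (E1 : fst (Cconj e * h z)%C + fst (e * g z)%C = Cmod (harmonic_map h g z)).
  { transitivity (fst (Cconj e * harmonic_map h g z)%C).
    - unfold harmonic_map. destruct e, (h z), (g z); simpl. ring.
    - rewrite Ef at 1.
      replace (Cconj e * (Cmod (harmonic_map h g z) * e))%C
        with (Cmod (harmonic_map h g z) * (e * Cconj e))%C by ring.
      rewrite <- Cmod2_conj, He. simpl. ring. }
  rewrite E1 in K. fold M. lra.
Qed.

(** * Covering *)

(** If the infimum were not attained, every point would have a neighbourhood on which
    [F] exceeds it by the radius of that neighbourhood (vacuously so outside the
    disk); by compactness one excess would serve everywhere, contradicting the
    choice of the infimum. *)
Lemma minimum_on_disk (F : C -> R) (rho : R) :
  0 <= rho ->
  (forall z : C, Cmod z <= rho -> 0 <= F z) ->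
  (forall z : C, Cmod z <= rho -> forall eps, 0 < eps -> exists delta, 0 < delta /\
     forall w : C, Cmod w <= rho -> Cmod (w - z) < delta -> F z - eps < F w) ->
  exists z0 : C, Cmod z0 <= rho /\ forall w : C, Cmod w <= rho -> F z0 <= F w.
Proof.
  intros Hrho Hpos Hlsc.
  destruct (completeness (fun y => exists z : C, Cmod z <= rho /\ y = - F z)) as [m [Hu Hl]].
  { exists 0. intros y [z [Hz ->]]. specialize (Hpos z Hz). lra. }
  { exists (- F 0), (RtoC 0). split; [rewrite Cmod_0; exact Hrho|reflexivity]. }
  assert (Hm : forall w : C, Cmod w <= rho -> - m <= F w).
  { intros w Hw. assert (- F w <= m); [|lra]. apply Hu. now exists w. }
  apply NNPP. intros Hno.
  assert (Hloc : forall p : C, exists delta, 0 < delta /\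
     forall w : C, Cmod w <= rho -> Cmod (w - p) < delta -> - m + delta <= F w).
  { intros p. destruct (Rle_dec (Cmod p) rho) as [Hp|Hp].
    - assert (Hlt : - m < F p).
      { apply Rnot_le_lt. intros Hle. apply Hno. exists p. split; [exact Hp|].
        intros w Hw. specialize (Hm w Hw). lra. }
      destruct (Hlsc p Hp ((F p + m) / 2)) as [d [Hd Hd']]; [lra|].
      exists (Rmin d ((F p + m) / 2)). split; [apply Rmin_pos; lra|].
      intros w Hw Hwp.
      assert (Cmod (w - p) < d) by (eapply Rlt_le_trans; [exact Hwp|apply Rmin_l]).
      pose proof (Rmin_r d ((F p + m) / 2)). specialize (Hd' w Hw H). lra.
    - exists (Cmod p - rho). split; [lra|]. intros w Hw Hwp. exfalso.
      assert (Cmod p <= Cmod w + Cmod (w - p)); [|lra].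
      replace p with (w + - (w - p))%C at 1 by ring.
      eapply Rle_trans; [apply Cmod_triangle|]. rewrite Cmod_opp. lra. }
  set (delta := fun p => proj1_sig (constructive_indefinite_description _ (Hloc p))).
  assert (Hdelta : forall p, 0 < delta p /\
     forall w : C, Cmod w <= rho -> Cmod (w - p) < delta p -> - m + delta p <= F w)
    by (intros p; exact (proj2_sig (constructive_indefinite_description _ (Hloc p)))).
  assert (Hhalf : forall u v, 0 < delta (u, v) / 2) by (intros u v; destruct (Hdelta (u, v)); lra).
  (* Two coordinates within half of delta keep the distance below delta. *)
  destruct (compactness_value_2d (- rho) rho (- rho) rho
              (fun u v => mkposreal _ (Hhalf u v))) as [d Hd].
  pose proof (cond_pos d) as Hd0.
  assert (m <= m - d); [|lra].
  apply Hl. intros y [z [Hz ->]].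
  assert (Hb : - rho <= fst z <= rho /\ - rho <= snd z <= rho).
  { pose proof (Rmax_Cmod z) as Hmax.
    pose proof (Rmax_l (Rabs (fst z)) (Rabs (snd z))).
    pose proof (Rmax_r (Rabs (fst z)) (Rabs (snd z))).
    split; apply Rabs_le_between; lra. }
  apply Rnot_lt_le. intros Hlt.
  apply (Hd (fst z) (snd z) (proj1 Hb) (proj2 Hb)).
  intros [u [v [_ [_ [H1 [H2 H3]]]]]]. simpl in *.
  destruct (Hdelta (u, v)) as [Hp Hw].
  assert (Hzp : Cmod (z - (u, v)) < delta (u, v)).
  { replace (z - (u, v))%C with ((fst z - u)%R + Ci * (snd z - v)%R)%C.
    - eapply Rle_lt_trans; [apply Cmod_triangle|].
      rewrite Cmod_mult, Cmod_Ci, !Cmod_R. lra.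
    - destruct z; unfold Ci, RtoC, Cminus, Cplus, Cmult, Copp; simpl. f_equal; ring. }
  specialize (Hw z Hz Hzp). lra.
Qed.

Lemma Cconj_R (x : R) : Cconj x = x.
Proof. unfold Cconj, RtoC; simpl. now rewrite Ropp_0. Qed.

Lemma Cmod_triangle_rev (z w : C) : Cmod z - Cmod w <= Cmod (z - w).
Proof.
  assert (Cmod z <= Cmod (z - w) + Cmod w); [|lra].
  replace z with (z - w + w)%C at 1 by ring. apply Cmod_triangle.
Qed.

Lemma cdiff_continuous (f : C -> C) (z l : C) : cdiff f z l ->
  forall eps, 0 < eps -> exists delta, 0 < delta /\
    forall w : C, Cmod (w - z) < delta -> Cmod (f w - f z) < eps.
Proof.
  intros H eps Heps. destruct (H 1 Rlt_0_1) as [d [Hd Hf]].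
  pose proof (Cmod_ge_0 l) as Hl.
  exists (Rmin d (eps / (Cmod l + 1))). split.
  - apply Rmin_pos; [exact Hd|apply Rdiv_lt_0_compat; lra].
  - intros w Hw.
    assert (H1 : Cmod (w - z) < d) by (eapply Rlt_le_trans; [exact Hw|apply Rmin_l]).
    assert (H2 : Cmod (w - z) < eps / (Cmod l + 1))
      by (eapply Rlt_le_trans; [exact Hw|apply Rmin_r]).
    specialize (Hf w H1).
    pose proof (Cmod_triangle_rev (f w - f z) (l * (w - z))) as T.
    rewrite Cmod_mult in T.
    apply (Rmult_lt_compat_r (Cmod l + 1)) in H2; [|lra].
    unfold Rdiv in H2. rewrite Rmult_assoc, Rinv_l in H2 by lra. lra.
Qed.

(** The map [v |-> A v + conj (B v)] has Jacobian [|A|^2 - |B|^2 > 0] and stretches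
    by at least [|A| - |B|]. *)
Lemma real_linear_surjective (A B u : C) : Cmod B < Cmod A ->
  exists v, (A * v + Cconj (B * v) = u)%C /\ (Cmod A - Cmod B) * Cmod v <= Cmod u.
Proof.
  intros H.
  assert (HJ : 0 < Cmod A ^ 2 - Cmod B ^ 2) by (pose proof (Cmod_ge_0 B); nra).
  set (J := Cmod A ^ 2 - Cmod B ^ 2) in *.
  set (v := (/ J * (Cconj A * u - Cconj B * Cconj u))%C).
  assert (E : (A * v + Cconj (B * v) = u)%C).
  { assert (EJ : J = fst A ^ 2 + snd A ^ 2 - (fst B ^ 2 + snd B ^ 2)).
    { unfold J. rewrite !Cmod2_alt. reflexivity. }
    unfold v. rewrite <- RtoC_inv by lra.
    destruct A as [a1 a2], B as [b1 b2], u as [u1 u2].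
    unfold Cconj, Cmult, Cplus, Cminus, Copp, RtoC; simpl fst in *; simpl snd in *.
    rewrite EJ in HJ |- *. f_equal; field; lra. }
  exists v. split; [exact E|].
  rewrite <- E.
  pose proof (Cmod_triangle_rev (A * v) (- Cconj (B * v))) as T.
  rewrite Cmod_opp, Cmod_conj, !Cmod_mult in T.
  replace (A * v - - Cconj (B * v))%C with (A * v + Cconj (B * v))%C in T by ring. lra.
Qed.

Lemma harmonic_map_continuous (h g : C -> C) (z A B : C) :
  cdiff h z A -> cdiff g z B ->
  forall eps, 0 < eps -> exists delta, 0 < delta /\
    forall w, Cmod (w - z) < delta ->
      Cmod (harmonic_map h g w - harmonic_map h g z) < eps.
Proof.
  intros Hh Hg eps Heps.
  destruct (cdiff_continuous _ _ _ Hh (eps / 2)) as [d1 [Hd1 C1]]; [lra|].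
  destruct (cdiff_continuous _ _ _ Hg (eps / 2)) as [d2 [Hd2 C2]]; [lra|].
  exists (Rmin d1 d2). split; [now apply Rmin_pos|].
  intros w Hw. pose proof (Rmin_l d1 d2). pose proof (Rmin_r d1 d2).
  specialize (C1 w ltac:(lra)). specialize (C2 w ltac:(lra)).
  replace (harmonic_map h g w - harmonic_map h g z)%C
    with ((h w - h z) + Cconj (g w - g z))%C
    by (unfold harmonic_map; rewrite Cminus_conj; ring).
  eapply Rle_lt_trans; [apply Cmod_triangle|]. rewrite Cmod_conj. lra.
Qed.

(** Solving [df (v) = w - f z] gives a direction along which [f] heads straight for
    [w], so that the distance drops at a relative rate
    [1 - kappa] for any [kappa > 0]; the
    stretching bound limits the length of [v]. *)
Lemma harmonic_map_descent (h g : C -> C) (z w A B : C) :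
  cdiff h z A -> cdiff g z B -> Cmod B < Cmod A -> harmonic_map h g z <> w ->
  exists v : C,
    (Cmod A - Cmod B) * Cmod v <= Cmod (harmonic_map h g z - w) /\
    forall kappa r : R, 0 < kappa -> 0 < r -> exists t : R,
      0 < t /\ t * Cmod v < r /\
      Cmod (harmonic_map h g (z + t * v) - w)
        <= (1 - t + kappa * t) * Cmod (harmonic_map h g z - w).
Proof.
  intros Hh Hg HAB Hne. set (f := harmonic_map h g) in *.
  set (D := (f z - w)%C) in *.
  assert (HD : 0 < Cmod D).
  { apply Cmod_gt_0. intros E. apply Hne.
    replace (f z) with (D + w)%C by (unfold D; ring). rewrite E. ring. }
  destruct (real_linear_surjective A B (- D) HAB) as [v [Ev Hv]].
  rewrite Cmod_opp in Hv. pose proof (Cmod_ge_0 v) as Hv0.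
  exists v. split; [exact Hv|]. intros kappa r Hk Hr.
  set (eps := kappa * Cmod D / (2 * (Cmod v + 1))).
  assert (Heps : 0 < eps)
    by (apply Rdiv_lt_0_compat; [now apply Rmult_lt_0_compat|lra]).
  assert (Heps' : 2 * eps * (Cmod v + 1) = kappa * Cmod D) by (unfold eps; field; lra).
  destruct (Hh eps Heps) as [d1 [Hd1 D1]].
  destruct (Hg eps Heps) as [d2 [Hd2 D2]].
  set (d := Rmin r (Rmin d1 d2)).
  assert (Hd : 0 < d) by (repeat apply Rmin_pos; lra).
  assert (Hda : d <= r) by apply Rmin_l.
  assert (Hdb : d <= d1) by (eapply Rle_trans; [apply Rmin_r|apply Rmin_l]).
  assert (Hdc : d <= d2) by (eapply Rle_trans; [apply Rmin_r|apply Rmin_r]).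
  (* The + 1 avoids dividing by zero and makes the displacement t v strictly
     shorter than d. *)
  set (t := Rmin 1 (d / (Cmod v + 1))).
  assert (Ht : 0 < t) by (apply Rmin_pos; [lra|apply Rdiv_lt_0_compat; lra]).
  assert (Ht1 : t <= 1) by apply Rmin_l.
  assert (Htv : t * Cmod v < d).
  { assert (t * (Cmod v + 1) <= d); [|nra].
    assert (H : t <= d / (Cmod v + 1)) by apply Rmin_r.
    apply (Rmult_le_compat_r (Cmod v + 1)) in H; [|lra].
    replace (d / (Cmod v + 1) * (Cmod v + 1)) with d in H by (field; lra). exact H. }
  exists t. split; [exact Ht|]. split; [lra|].
  set (z1 := (z + t * v)%C).
  assert (E1 : (z1 - z = t * v)%C) by (unfold z1; ring).
  assert (M1 : Cmod (z1 - z) = t * Cmod v)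
    by (rewrite E1, Cmod_mult, Cmod_R, Rabs_pos_eq; lra).
  specialize (D1 z1 ltac:(lra)). specialize (D2 z1 ltac:(lra)). rewrite M1 in D1, D2.
  set (R1 := (h z1 - h z - A * (z1 - z))%C) in *.
  set (R2 := (g z1 - g z - B * (z1 - z))%C) in *.
  assert (Ef : (f z1 - w = (1 - t)%R * D + (R1 + Cconj R2))%C).
  { replace ((1 - t)%R * D)%C with (D + t * (A * v + Cconj (B * v)))%C
      by (rewrite Ev, RtoC_minus; ring).
    unfold R1, R2, D, f, harmonic_map. rewrite E1.
    rewrite !Cminus_conj, !Cmult_conj, Cconj_R. ring. }
  rewrite Ef. eapply Rle_trans; [apply Cmod_triangle|].
  rewrite Cmod_mult, Cmod_R, Rabs_pos_eq by lra.
  assert (BR : Cmod (R1 + Cconj R2) <= 2 * eps * (t * Cmod v)).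
  { eapply Rle_trans; [apply Cmod_triangle|]. rewrite Cmod_conj. lra. }
  assert (2 * eps * (t * Cmod v) <= t * (kappa * Cmod D)).
  { rewrite <- Heps'. assert (0 <= t * eps) by nra. nra. }
  lra.
Qed.

(** Minimise [|f z - w| + c Phi (|z|)] over the closed disk of radius [rho], where
    [Phi (x)] is the integral of [((1 - s) / (1 + s)) ^ lambda] up to [x] and [c < 1] is close
    enough to 1 for [c Phi rho] to exceed [|w|], the value at 0. The minimum is then
    interior, and if [f] missed [w] there, moving towards [w] would decrease the
    distance faster than the penalty grows. *)
Lemma covering (lambda : R) (h g : C -> C) (a b : nat -> C) (w : C) :
  0 <= lambda ->
  represents a h -> represents b g -> class_BH lambda h g ->
  sense_preserving h g -> C_derive g 0 = 0 ->
  Cmod w < - H_at_m1 lambda ->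
  exists z, in_disk z /\ harmonic_map h g z = w.
Proof.
  intros Hl Ha Hb HB Hs Hg0 Hw.
  destruct (H_at_m1_approx lambda (Cmod w) Hl Hw) as [rho [Hrho HPhi]].
  set (Phi := H_refl lambda) in *. set (f := harmonic_map h g).
  pose proof (Cmod_ge_0 w) as Hw0.
  (* The midpoint of |w| / Phi rho and 1, so that c < 1 and c Phi rho > |w|. *)
  set (c := (Cmod w / Phi rho + 1) / 2).
  assert (HcP : c * Phi rho = (Cmod w + Phi rho) / 2) by (unfold c; field; lra).
  assert (Hc : 0 < c < 1).
  { split; apply (Rmult_lt_reg_r (Phi rho)); rewrite ?HcP; lra. }
  assert (Hmono : forall x y, 0 <= x -> x <= y -> y < 1 -> Phi x <= Phi y)
    by (intros x y Hx Hxy Hy; apply H_refl_monotone; lra).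
  assert (Hstep : forall x y k, 0 <= x < 1 -> 0 <= y < 1 -> 0 <= k -> y <= x + k ->
            Phi y <= Phi x + H_integrand lambda (- x) * k).
  { intros x y k Hx Hy Hk Hyk. pose proof (H_integrand_pos lambda (- x)) as HP.
    destruct (Rle_dec y x) as [Hyx|Hyx].
    - assert (Phi y <= Phi x) by (apply Hmono; lra). nra.
    - assert (Phi y <= Phi x + H_integrand lambda (- x) * (y - x))
        by (apply H_refl_concave; lra). nra. }
  assert (HP1 : forall x, 0 <= x < 1 -> H_integrand lambda (- x) <= 1).
  { intros x Hx. rewrite <- (H_integrand_0 lambda). apply H_integrand_monotone; lra. }
  set (F := fun z : C => Cmod (f z - w) + c * Phi (Cmod z)).
  assert (HPhi0 : forall x, 0 <= x < 1 -> 0 <= Phi x).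
  { intros x Hx. pose proof (Hmono 0 x). unfold Phi in H at 1. rewrite H_refl_0 in H. lra. }
  destruct (minimum_on_disk F rho) as [z0 [Hz0 Hmin]].
  - lra.
  - intros z Hz. pose proof (Cmod_ge_0 z). pose proof (Cmod_ge_0 (f z - w)).
    pose proof (HPhi0 (Cmod z)). unfold F.
    apply Rplus_le_le_0_compat; [assumption|apply Rmult_le_pos; lra].
  - intros z Hz eps Heps.
    assert (Hzd : in_disk z) by (unfold in_disk; lra).
    destruct (harmonic_map_continuous h g z _ _ (represents_cdiff a h z Ha Hzd)
                (represents_cdiff b g z Hb Hzd) (eps / 2)) as [d [Hd Hcont]]; [lra|].
    exists (Rmin d (eps / 2)). split; [apply Rmin_pos; lra|].
    intros y Hy Hyz.
    pose proof (Rmin_l d (eps / 2)). pose proof (Rmin_r d (eps / 2)).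
    specialize (Hcont y ltac:(lra)). fold f in Hcont.
    assert (T1 : Cmod (f z - w) - Cmod (f y - w) <= Cmod (f y - f z)).
    { eapply Rle_trans; [apply Cmod_triangle_rev|].
      replace (f z - w - (f y - w))%C with (- (f y - f z))%C by ring.
      rewrite Cmod_opp. apply Rle_refl. }
    assert (T2 : Phi (Cmod z) <= Phi (Cmod y) + 1 * Cmod (y - z)).
    { pose proof (Cmod_ge_0 z). pose proof (Cmod_ge_0 y). pose proof (Cmod_ge_0 (y - z)).
      eapply Rle_trans; [apply (Hstep (Cmod y) (Cmod z) (Cmod (y - z))); try lra|].
      - pose proof (Cmod_triangle_rev z y) as T.
        replace (z - y)%C with (- (y - z))%C in T by ring. rewrite Cmod_opp in T. lra.
      - apply Rplus_le_compat_l, Rmult_le_compat_r; [assumption|]. apply HP1. lra. }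
    unfold F.
    assert (c * Phi (Cmod z) <= c * Phi (Cmod y) + Cmod (y - z)).
    { pose proof (Cmod_ge_0 (y - z)). nra. }
    lra.
  - assert (Hz0p := Cmod_ge_0 z0).
    assert (Hlt : Cmod z0 < rho).
    { assert (HF0 : F z0 <= F 0) by (apply Hmin; rewrite Cmod_0; lra).
      assert (E0 : F 0 = Cmod w).
      { unfold F, f, harmonic_map. destruct HB as [[_ [_ [h0 [g0 _]]]] _].
        rewrite h0, g0, Cmod_0. unfold Phi. rewrite H_refl_0.
        replace (0 + Cconj 0 - w)%C with (- w)%C.
        - rewrite Cmod_opp. ring.
        - rewrite Cconj_R. ring. }
      destruct (Rle_lt_or_eq_dec _ _ Hz0) as [|Heq]; [assumption|exfalso].
      unfold F in HF0 at 1. rewrite Heq, E0, HcP in HF0.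
      pose proof (Cmod_ge_0 (f z0 - w)). lra. }
    assert (Hd0 : in_disk z0) by (unfold in_disk; lra).
    exists z0. split; [exact Hd0|]. fold f.
    apply NNPP. intros Hne.
    destruct (harmonic_map_descent h g z0 w _ _ (represents_cdiff a h z0 Ha Hd0)
                (represents_cdiff b g z0 Hb Hd0) (Hs z0 Hd0) Hne) as [v [Hv Hdesc]].
    fold f in Hv, Hdesc. set (D := (f z0 - w)%C) in *.
    assert (HD : 0 < Cmod D).
    { apply Cmod_gt_0. intros E. apply Hne. fold f.
      replace (f z0) with (D + w)%C by (unfold D; ring). rewrite E. ring. }
    pose proof (diff_derivatives_bound lambda h g a b z0 Ha Hb HB Hs Hg0 Hd0) as HPz.
    pose proof (Cmod_ge_0 v) as Hv0.
    assert (Hv' : H_integrand lambda (- Cmod z0) * Cmod v <= Cmod D) by nra.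
    destruct (Hdesc ((1 - c) / 2) (rho - Cmod z0)) as [t [Ht [Htv Bf]]]; [lra|lra|].
    set (z1 := (z0 + t * v)%C) in *.
    assert (Hz1 : Cmod z1 <= Cmod z0 + t * Cmod v).
    { unfold z1. eapply Rle_trans; [apply Cmod_triangle|].
      rewrite Cmod_mult, Cmod_R, Rabs_pos_eq; lra. }
    pose proof (Cmod_ge_0 z1) as Hz1p.
    assert (Hmin1 : F z0 <= F z1) by (apply Hmin; lra).
    assert (BP : Phi (Cmod z1) <= Phi (Cmod z0) + t * Cmod D).
    { assert (Htv0 : 0 <= t * Cmod v) by (apply Rmult_le_pos; lra).
      eapply Rle_trans; [apply (Hstep (Cmod z0) (Cmod z1) (t * Cmod v)); lra|].
      apply Rplus_le_compat_l. apply (Rmult_le_compat_l t) in Hv'; [|lra].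
      rewrite <- Rmult_assoc, (Rmult_comm _ t), Rmult_assoc. exact Hv'. }
    unfold F in Hmin1. fold D in Hmin1.
    assert (BP' := Rmult_le_compat_l c _ _ (Rlt_le _ _ (proj1 Hc)) BP).
    (* The distance to w drops by at least (1 + c) / 2 * t |D|, the penalty grows
       by at most c t |D|, and c < (1 + c) / 2. *)
    assert (0 < t * ((1 - c) * Cmod D)) by (repeat apply Rmult_lt_0_compat; lra).
    nra.
Qed.

(** * The three conclusions *)

Theorem corollary3p1 :
  forall (lambda : R) (h g : C -> C) (a b : nat -> C),
    0 <= lambda ->
    disk_expansion a h ->
    disk_expansion b g ->
    class_BH lambda h g ->
    (1 < lambda ->
       bigO_at_circle (harmonic_map h g)
         (fun r : R => Rpower (1 - r) (1 - lambda))) /\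
    (lambda < 1 ->
       forall z : C, in_disk z ->
         Cmod (harmonic_map h g z) <= (1 + Cmod (b 1%nat)) * H_at_1 lambda) /\
    (0 < lambda -> class_SH0 h g ->
       forall w : C, Cmod w < - H_at_m1 lambda ->
         exists z : C, in_disk z /\ harmonic_map h g z = w).
Proof.
  intros lambda h g a b Hl Ha Hb HB.
  apply disk_expansion_represents in Ha. apply disk_expansion_represents in Hb.
  assert (Hg : forall z, in_disk z ->
    Cmod (harmonic_map h g z) <= (1 + Cmod (C_derive g 0)) * H_fun lambda (Cmod z))
    by (intros z Hz; eapply growth_bound; eassumption).
  pose proof (Cmod_ge_0 (C_derive g 0)) as Hg0.
  split; [|split].
  - intros Hl1. exists ((1 + Cmod (C_derive g 0)) * (Rpower 2 lambda / (lambda - 1))), 0.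
    split; [lra|]. intros z Hz.
    assert (Hp : 0 < Rpower (1 - Cmod z) (1 - lambda)) by apply exp_pos.
    rewrite Rabs_pos_eq, Rmult_assoc by lra.
    eapply Rle_trans; [apply Hg; unfold in_disk; lra|].
    apply Rmult_le_compat_l; [lra|].
    eapply Rle_trans; [apply H_fun_upper; lra|].
    assert (0 < Rpower 2 lambda / (lambda - 1))
      by (apply Rdiv_lt_0_compat; [apply exp_pos|lra]).
    replace (Rpower 2 lambda / (1 - lambda)) with (- (Rpower 2 lambda / (lambda - 1)))
      by (field; lra).
    nra.
  - intros Hl1 z Hz.
    assert (Eb : C_derive g 0 = b 1%nat).
    { rewrite (represents_at_0 _ _ (represents_derive _ _ Hb)). simpl. ring. }
    rewrite <- Eb. eapply Rle_trans; [now apply Hg|].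
    apply Rmult_le_compat_l; [lra|]. unfold in_disk in Hz. pose proof (Cmod_ge_0 z).
    apply H_fun_le_H_at_1; lra.
  - intros _ [_ [Hs [_ Hgz]]] w Hw.
    exact (covering lambda h g _ _ w Hl Ha Hb HB Hs Hgz Hw).
Qed.
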